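(* Let $g\ge4$ be an integer, and let $H$ be an acyclic oriented graph with $p(H)=4$, $\tau(H)=8$, and $\operatorname{girth}(U(H))>g$. Then $$|V(H)|\ge 3\cdot2^{\lfloor g/4\rfloor}-2.$$ In particular, $m_g(4)\ge 3\cdot2^{\lfloor g/4\rfloor}-2$ for every integer $g\ge4$, and $m_g(4)=2^{\Theta(g)}$ as $g\to\infty$. Consequently, $m_g(p)$ has no upper bound polynomial jointly in $p$ and $g$ (i.e. there is no polynomial $P$ in two variables with $m_g(p)\le P(p,g)$ for all integers $p\ge3$, $g\ge1$).
   Context: All graphs and digraphs are finite. An oriented graph is a loopless digraph with no pair of opposite arcs (and no parallel arcs); it is acyclic if it has no directed cycle. $U(H)$ denotes the underlying simple undirected graph of $H$; $H$ is connected if $U(H)$ is connected. The girth of a graph is the length of a shortest cycle ($\infty$ for a forest). A tournament is an orientation of a complete graph. A homomorphism is a vertex map preserving every arc. $\vec{T}_k$ is the transitive tournament on $[k]$, with arcs $ij$ for $i<j$. For a nonempty acyclic oriented graph $H$, $p(H)$ is the maximum number of vertices on a directed path in $H$. The compressibility $\tau(H)$ is the least positive integer $n$ such that $H$ admits a homomorphism to every tournament of order $n$. $r_{\mathrm{tr}}(p)$ is the least $n$ such that every tournament of order $n$ contains $\vec{T}_p$. Two vertices are linked if they are the endpoints of a directed path of length at most two, in either direction. $\omega_{\mathrm{ro}}(H)$ is the maximum order of a set of vertices pairwise linked in $H$. An oriented clique is an oriented graph in which every two vertices are linked within that graph; $\omega_{\mathrm{ao}}(H)$ is the maximum order of an oriented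 clique that is a subgraph of $H$. For integers $p\ge3$, $g\ge1$, let $\mathcal H_g(p)$ be the family of connected acyclic oriented graphs $H$ such that $\operatorname{girth}(U(H))>g$, $\omega_{\mathrm{ao}}(H)=\omega_{\mathrm{ro}}(H)=3$, $p(H)=p$ and $\tau(H)=r_{\mathrm{tr}}(p)$. This family is nonempty for all such $p,g$. Define $m_g(p)=\min_{H\in\mathcal H_g(p)}|V(H)|$. *)

(* Defs.v *)
From mathcomp Require Import all_boot all_order all_algebra.
From mathcomp Require Import all_classical all_reals all_analysis.

Set Implicit Arguments.
Unset Strict Implicit.
Unset Printing Implicit Defensive.

(* Junk value 0 if no natural number satisfies P. *)
Definition least (P : nat -> Prop) : nat :=
  if pselect (exists n, `[< P n >]) is left exP then ex_minn exP else 0.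

Lemma leastP (P : nat -> Prop) (n : nat) :
  P n -> P (least P) /\ least P <= n.
Proof.
move=> Pn; rewrite /least; case: pselect => [exP|nexP]; last first.
  by case: nexP; exists n; apply/asboolP.
by case: ex_minnP => m /asboolP Pm min_m; split=> //; apply/min_m/asboolP.
Qed.

Record ograph := OGraph {
  vertex :> finType;
  arc : rel vertex;
  arc_irr : irreflexive arc;
  arc_asym : forall x y, arc x y -> ~~ arc y x
}.
Arguments arc {o} x y.

Definition uadj (H : ograph) : rel H := fun x y => arc x y || arc y x.

(* [ucycle] also accepts the empty sequence, which is not a directed cycle. *)
Definition acyclic (H : ograph) : Prop :=
  forall c : seq H, ucycle arc c -> c = [::].

Definition gconnected (H : ograph) : Prop :=
  forall x y : H, connect (@uadj H) x y.

(* The bound 3 excludes an edge traversed back and forth. *)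
Definition has_cycle (H : ograph) (n : nat) : Prop :=
  3 <= n /\ exists2 c : seq H, ucycle (@uadj H) c & size c = n.

(* Girth of the underlying graph; None stands for infinity. *)
Definition girth (H : ograph) : option nat :=
  if `[< exists n, has_cycle H n >] then Some (least (has_cycle H)) else None.

Definition girth_gt (H : ograph) (g : nat) : bool :=
  if girth H is Some n then g < n else true.

Definition dipath (H : ograph) (s : seq H) : bool := sorted arc s && uniq s.

(* Number of vertices (not arcs) on a longest directed path. *)
Definition pathnum (H : ograph) : nat :=
  \max_(n < #|H|.+1 | [exists s : n.-tuple H, dipath s]) n.

Definition is_hom (H T : ograph) (f : H -> T) : Prop :=
  forall x y, arc x y -> arc (f x) (f y).

Definition is_tournament (T : ograph) : Prop :=
  forall x y : T, x != y -> arc x y || arc y x.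

Definition compressibility (H : ograph) : nat :=
  least (fun n => 0 < n /\
    forall T : ograph, is_tournament T -> #|T| = n ->
      exists f : H -> T, is_hom f).

Definition ttarc (k : nat) : rel 'I_k := fun i j => i < j.

Fact ttarc_irr k : irreflexive (@ttarc k).
Proof. by move=> i; rewrite /ttarc ltnn. Qed.

Fact ttarc_asym k (i j : 'I_k) : ttarc i j -> ~~ ttarc j i.
Proof. by rewrite /ttarc -leqNgt => /ltnW. Qed.

Definition transitive_tournament (k : nat) : ograph :=
  OGraph (@ttarc_irr k) (@ttarc_asym k).

Definition contains (T F : ograph) : Prop :=
  exists2 f : F -> T, injective f & is_hom f.

Definition r_tr (p : nat) : nat :=
  least (fun n => forall T : ograph, is_tournament T -> #|T| = n ->
    contains T (transitive_tournament p)).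

(* For a loopless relation without opposite pairs, linked vertices are distinct. *)
Definition linked (V : finType) (e : rel V) (x y : V) : bool :=
  [|| e x y, e y x, [exists z, e x z && e z y] | [exists z, e y z && e z x]].

Definition pairwise_linked (V : finType) (e : rel V) (S : {set V}) : bool :=
  [forall x in S, forall y in S, (x != y) ==> linked e x y].

Definition omega_ro (H : ograph) : nat :=
  \max_(S : {set H} | pairwise_linked arc S) #|S|.

(* (S, A) is a subgraph of H, not necessarily induced. *)
Definition is_subgraph (H : ograph) (S : {set H}) (A : {set H * H}) : bool :=
  [forall a in A, [&& a.1 \in S, a.2 \in S & arc a.1 a.2]].

Definition omega_ao (H : ograph) : nat :=
  \max_(S : {set H} | [exists A : {set H * H}, is_subgraph S A &&
     pairwise_linked (fun x y => (x, y) \in A) S]) #|S|.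

Definition family (g p : nat) (H : ograph) : Prop :=
  [/\ gconnected H /\ acyclic H, girth_gt H g,
      omega_ao H = 3 /\ omega_ro H = 3,
      pathnum H = p & compressibility H = r_tr p].

Definition min_order (g p : nat) : nat :=
  least (fun n => exists2 H : ograph, family g p H & #|H| = n).

(* Main.v *)
(* Lower bound. An acyclic graph with at most k vertices on each directed path
   maps to the transitive tournament on k vertices, so tau(H) = 8 produces a
   tournament T on 7 vertices, without transitive subtournament of order 4, to
   which H does not map.  Such a T is doubly regular: all in- and out-degrees
   are 3, and two vertices have at most one common out- or in-neighbour.  Hence
   the two inner vertices of a path with three arcs, however oriented, can be
   coloured for any colours of its ends.  A vertex-critical subgraph of H with
   no homomorphism to T thus has minimum degree at least 2 and no two adjacent
   vertices of degree 2, so around a vertex of degree at least 3 the spheres at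
   least double every two steps as long as they stay in a tree.

   Upper bound. Let N = 2^(O(g)) and join four layers of N vertices by random
   arcs directed upwards, a constant number per vertex.  With positive
   probability there are few short cycles, and any two sets of size N/8 in
   distinct layers are joined.  Delete a vertex of each short cycle: a
   homomorphism to the Paley tournament on 7 vertices would have a popular
   colour in each layer, and these four colours would form a transitive
   tournament, which does not exist.  A vertex-critical subgraph is connected and
   belongs to the family, because large girth keeps pairwise linked sets small. *)
Require Import Defs.
From mathcomp Require Import all_boot zify boolp.
(* [path] also defines [arc] and would shadow the one of [ograph]. *)
Import Defs.

Set Implicit Arguments.
Unset Strict Implicit.
Unset Printing Implicit Defensive.

(** * Girth, induced subgraphs and critical subgraphs *)

Lemma girth_gtP (H : ograph) g :
  girth_gt H g <->
  (forall c : seq H, ucycle (@uadj H) c -> 3 <= size c -> g < size c).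
Proof.
rewrite /girth_gt /girth; split.
  case: asboolP => [[n Hn]|noH] Hg c uc c3.
    have /leastP[_ le_c] : has_cycle H (size c) by split=> //; exists c.
    exact: leq_trans Hg le_c.
  by case: noH; exists (size c); split=> //; exists c.
case: asboolP => // -[n /leastP[[c3 [c uc sc]] _]] Hg.
by rewrite -sc; apply: Hg => //; rewrite sc.
Qed.

Lemma uadjC (H : ograph) : symmetric (@uadj H).
Proof. by move=> x y; rewrite /uadj orbC. Qed.

Lemma uadj_irr (H : ograph) : irreflexive (@uadj H).
Proof. by move=> x; rewrite /uadj arc_irr. Qed.

Section Induced.
Variables (H : ograph) (A : {set H}).

Definition induced_arc : rel {x : H | x \in A} :=
  fun x y => arc (val x) (val y).

Fact induced_irr : irreflexive induced_arc.
Proof. by move=> x; apply: arc_irr. Qed.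

Fact induced_asym x y : induced_arc x y -> ~~ induced_arc y x.
Proof. exact: arc_asym. Qed.

Definition induced : ograph := OGraph induced_irr induced_asym.

Lemma card_induced : #|induced| = #|A|.
Proof. by rewrite card_sig; apply: eq_card. Qed.

Lemma girth_induced g : girth_gt H g -> girth_gt induced g.
Proof.
move=> /girth_gtP Hg; apply/girth_gtP => c /andP[cc uc] c3.
rewrite -(size_map val c); apply: Hg; rewrite ?size_map //.
by rewrite /ucycle map_inj_uniq ?uc ?andbT ?cycle_map //; apply: val_inj.
Qed.

End Induced.

Definition hom_on (H T : ograph) (B : {set H}) (f : H -> T) :=
  {in B &, forall x y, arc x y -> arc (f x) (f y)}.

Lemma hom_induced (H T : ograph) (A : {set H}) (t : T) :
  (exists f : induced A -> T, is_hom f) <-> exists f : H -> T, hom_on A f.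
Proof.
split=> -[f hf]; last first.
  by exists (fun x => f (val x)) => x y; apply: hf; apply: valP.
exists (fun x => if insub x is Some y then f y else t) => x y xA yA xy.
by rewrite !insubT; apply: hf.
Qed.

(** Take [A] minimal among the vertex sets on which no map to [T] is a homomorphism; a proper subset
    of [induced A] projects to a proper subset of [A]. *)
Lemma critical_subgraph (H T : ograph) (t : T) :
  ~ (exists f : H -> T, is_hom f) ->
  exists A : {set H}, ~ (exists f : induced A -> T, is_hom f) /\
    forall B : {set induced A}, B != setT -> exists f, hom_on (T := T) B f.
Proof.
move=> nohom.
pose bad (B : {set H}) := ~~ `[< exists f : H -> T, hom_on B f >].
have badT : exists B, bad B.
  exists setT; apply/asboolP => -[f hf]; apply: nohom.
  by exists f => x y; apply: hf; rewrite inE.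
have [A /minsetP[badA minA]] := ex_minset badT.
exists A; split=> [/(hom_induced A t)|B BT]; first by move/asboolP: badA.
pose B' := [set val x | x in B].
have sB' : B' \proper A.
  rewrite properE; apply/andP; split.
    by apply/subsetP => _ /imsetP[x _ ->]; apply: valP.
  apply: contra BT => /subsetP sAB; apply/eqP/setP => x; rewrite inE.
  by have /sAB/imsetP[y yB /val_inj->] := valP x.
have /asboolP[f hf] : `[< exists f : H -> T, hom_on B' f >].
  apply: contraT => /minA/(_ (proper_sub sB')) eqB'.
  by rewrite eqB' properxx in sB'.
exists (fun x => f (val x)) => x y xB yB; apply: hf; exact: imset_f.
Qed.

(** No arc crosses between a component and its complement, so homomorphisms on these two proper
    parts would glue. *)
Lemma critical_connected (H T : ograph) :
  ~ (exists f : H -> T, is_hom f) ->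
  (forall B : {set H}, B != setT -> exists f, hom_on (T := T) B f) ->
  gconnected H.
Proof.
move=> nohom crit x y; apply: contraT => nxy; case: nohom.
have symc : connect_sym (@uadj H) by apply/sym_connect_sym/uadjC.
pose B := [set z | connect (@uadj H) x z].
have [|f hf] := crit B.
  by apply: contra nxy => /eqP/setP/(_ y); rewrite !inE.
have [|f' hf'] := crit (~: B).
  by apply/negP => /eqP/setP/(_ x); rewrite !inE connect0.
exists (fun z => if z \in B then f z else f' z) => u v uv.
have eqB : (u \in B) = (v \in B).
  rewrite !inE; apply: same_connect_r => //; apply: connect1.
  by rewrite /uadj uv.
rewrite eqB; case: (boolP (v \in B)) => vB.
  by apply: hf; rewrite ?eqB.
by apply: hf'; rewrite ?in_setC ?eqB.
Qed.

(** * Heights, layers and transitive tournaments *)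

Section Height.
Variable H : ograph.
Hypothesis acH : acyclic H.

(** Counts arcs, not vertices, on a longest directed path starting at [x]. *)
Definition height (x : H) : nat :=
  \max_(n < #|H|.+1 | [exists s : n.-tuple H, path arc x s && uniq (x :: s)]) n.

Lemma height_geq (x : H) s : path arc x s -> uniq (x :: s) -> size s <= height x.
Proof.
move=> ps us; have ltn : size s < #|H|.+1.
  by rewrite ltnS -(card_uniqP (proj2 (andP us))) max_card.
apply: (bigmax_sup (Ordinal ltn)) => //.
by apply/existsP; exists (in_tuple s); apply/andP.
Qed.

Lemma height_witness (x : H) :
  exists s, [/\ path arc x s, uniq (x :: s) & size s = height x].
Proof.
have nil0 : [exists s : 0.-tuple H, path arc x s && uniq (x :: s)].
  by apply/existsP; exists [tuple].
have [|i /existsP[s /andP[ps us]] hi] := @eq_bigmax_cond _ [pred n : 'I_#|H|.+1 |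
    [exists s : n.-tuple H, path arc x s && uniq (x :: s)]] val.
  by apply/card_gt0P; exists ord0; rewrite inE.
by exists s; split; rewrite // /height hi size_tuple.
Qed.

Lemma height_arc (x y : H) : arc x y -> height y < height x.
Proof.
move=> xy; have [s [ps us <-]] := height_witness y.
apply: (@height_geq x (y :: s)); first by rewrite /= xy.
rewrite cons_uniq us andbT.
(* If [x] lay on the longest path from [y], the piece up to [x] and the arc from [x] to [y] would
   close a directed cycle. *)
apply/negP; rewrite inE => /predU1P[eqxy|xs]; first by rewrite eqxy arc_irr in xy.
move: ps us xy; case/path.splitP: xs => p1 p2.
rewrite cat_path -cat_cons cat_uniq => /andP[pp1 _] /andP[up1 _] xy.
suff /acH : ucycle arc (y :: rcons p1 x) by [].
by rewrite /ucycle up1 andbT /= rcons_path pp1 last_rcons.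
Qed.

Lemma height_pathnum (x : H) : height x < pathnum H.
Proof.
have [s [ps us <-]] := height_witness x.
have ltn : size (x :: s) < #|H|.+1.
  by rewrite ltnS -(card_uniqP us) max_card.
apply: (bigmax_sup (Ordinal ltn)) => //.
by apply/existsP; exists (in_tuple (x :: s)); apply/andP.
Qed.

(** Heights fall along arcs and stay below [k], so reversing their order gives the map. *)
Lemma hom_transitive k : pathnum H <= k ->
  exists f : H -> transitive_tournament k, is_hom f.
Proof.
move=> le_k; have lt_k (x : H) : k - (height x).+1 < k.
  by have := height_pathnum x; lia.
exists (fun x => Ordinal (lt_k x)) => x y /height_arc xy.
by rewrite /arc /= /ttarc /=; have := height_pathnum x; lia.
Qed.

End Height.

Section Layers.
Variables (H : ograph) (k : nat) (f : H -> transitive_tournament k).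
Hypothesis homf : is_hom f.

Lemma layered_path_ltn (x : H) s : path arc x s -> forall y, y \in s -> (f x < f y)%N.
Proof.
elim: s x => //= z s IHs x /andP[/homf xz /IHs zs] y.
by rewrite inE => /predU1P[->//|/zs]; apply: ltn_trans.
Qed.

Lemma acyclic_layered : acyclic H.
Proof.
case=> // x s /andP[/=]; rewrite rcons_path => /andP[ps lx] _.
have /layered_path_ltn/(_ x) : path arc x (rcons s x) by rewrite rcons_path ps.
by rewrite mem_rcons mem_head ltnn => /(_ isT).
Qed.

Lemma pathnum_layered : pathnum H <= k.
Proof.
apply/bigmax_leqP => -[n ltn] /= /existsP[s /andP[ps us]].
have inj : uniq (map f s).
  case: (tval s) ps => //= x s'; elim: s' x => //= y s' IHs x /andP[xy ps].
  rewrite IHs // andbT; apply/negP => /(@mapP _ _ f (y :: s'))[z zs eqf].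
  have /layered_path_ltn/(_ z zs) : path arc x (y :: s') by rewrite /= xy ps.
  by rewrite eqf ltnn.
by rewrite -(size_tuple s) -(size_map f) -(card_uniqP inj) -[k in _ <= k]card_ord max_card.
Qed.

End Layers.

(** * Tournaments without transitive subtournament of order 4 *)

Lemma sum_bool_card (T : finType) (W : {set T}) (P : pred T) :
  \sum_(x in W) (P x : nat) = #|[set x in W | P x]|.
Proof.
rewrite -sum1_card [RHS](eq_bigl [pred x | (x \in W) && P x]).
  by rewrite [RHS]big_mkcondr; apply: eq_bigr => x _; case: (P x).
by move=> x; rewrite !inE.
Qed.

Section Tournament.
Variable T : ograph.
Hypothesis tourT : is_tournament T.

(** Averaging: the out-degrees inside [W] sum to half of [|W| (|W| - 1)]. *)
Lemma tournament_outdeg (W : {set T}) m : 0 < m -> m.*2 <= #|W| ->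
  exists2 x, x \in W & m <= #|[set y in W | arc x y]|.
Proof.
move=> m0 mW; case: (pickP [pred x in W | m <= #|[set y in W | arc x y]|]).
  by move=> x /andP[]; exists x.
move=> small.
pose out := \sum_(x in W) \sum_(y in W) (arc x y : nat).
have out_lt : out <= #|W| * m.-1.
  rewrite -sum_nat_const; apply: leq_sum => x xW.
  rewrite sum_bool_card.
  by have := small x; rewrite /= xW /= => /negbT; lia.
have out2 : out + out = #|W| * #|W|.-1.
  rewrite {2}/out exchange_big -big_split /= -sum_nat_const.
  apply: eq_bigr => x xW; rewrite -big_split /= (bigD1 x) //= arc_irr add0n.
  rewrite (cardD1 x) xW /= -sum1_card.
  apply: eq_big => [y|y /andP[yW yx]]; first by rewrite !inE andbC.
  have := tourT yx; have := @arc_asym T x y.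
  by case: (arc x y) => [/(_ isT)/negbTE->|_] //; rewrite orbF => ->.
by move: out_lt out2 mW; move: out #|W| => o w; nia.
Qed.

(** Pick a vertex with many out-neighbours in [W] and recurse among them; the size bound halves at
    each step. *)
Lemma tournament_transitive p (W : {set T}) : 2 ^ p <= #|W| ->
  exists s, [/\ size s = p.+1, pairwise arc s & {subset s <= W}].
Proof.
elim: p W => [|p IHp] W.
  case/card_gt0P => x xW; exists [:: x]; split=> // y.
  by rewrite inE => /eqP->.
rewrite expnS mul2n => /tournament_outdeg[|x xW /IHp[s [ss ps sW]]].
  by rewrite expn_gt0.
exists (x :: s); split; rewrite /= ?ss ?ps ?andbT //.
  by apply/allP => y /sW; rewrite inE => /andP[].
by move=> y; rewrite inE => /predU1P[->//|/sW]; rewrite inE => /andP[].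
Qed.

Lemma contains_pairwise (s : seq T) :
  pairwise arc s -> contains T (transitive_tournament (size s)).
Proof.
case: s => [_|x s]; first by exists (fun i : 'I_0 => match i with Ordinal _ h =>
  False_rect _ (notF h) end); case.
move=> /(pairwiseP x) ps.
have hom : is_hom (fun i : transitive_tournament (size (x :: s)) => nth x (x :: s) i).
  by move=> i j ij; apply: ps; rewrite // inE ltn_ord.
exists (fun i : transitive_tournament (size (x :: s)) => nth x (x :: s) i) => // i j eqij; apply/val_inj/eqP.
case: (ltngtP i j) => // [/hom|/hom]; by rewrite eqij arc_irr.
Qed.

Lemma contains_transitive p : 2 ^ p <= #|T| ->
  contains T (transitive_tournament p.+1).
Proof.
rewrite -cardsT => /tournament_transitive[s [<- ps _]].
exact: contains_pairwise.
Qed.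

(** The sign [s] lets one statement cover every orientation of a path. *)
Definition nbr (s : bool) (x : T) : {set T} :=
  [set y | if s then arc x y else arc y x].

Hypothesis freeT : ~ contains T (transitive_tournament 4).
Hypothesis card7 : #|T| = 7.

Lemma free_pairwise (s : seq T) : size s = 4 -> ~ pairwise arc s.
Proof. by move=> s4 /contains_pairwise; rewrite s4. Qed.

(** Four neighbours of one sign would contain a transitive triple, which [x] extends to order 4. So
    both degrees are at most 3, and they sum to 6. *)
Lemma card_nbr s x : #|nbr s x| = 3.
Proof.
have le3 b : #|nbr b x| <= 3.
  rewrite leqNgt; apply/negP => /(@tournament_transitive 2)[t [t3 pt tN]].
  case: b tN => tN.
    apply: (@free_pairwise (x :: t)); rewrite /= ?t3 // pt andbT.
    by apply/allP => y /tN; rewrite inE.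
  apply: (@free_pairwise (rcons t x)); rewrite ?size_rcons ?t3 //.
  by rewrite pairwise_rcons pt andbT; apply/allP => y /tN; rewrite inE.
have eqU : nbr true x :|: nbr false x = [set~ x].
  apply/setP => y; rewrite !inE; case: (eqVneq y x) => [->|/tourT].
    by rewrite arc_irr.
  by rewrite orbC => ->.
have [+ _] := leq_card_setU (nbr true x) (nbr false x).
rewrite eqU cardsC1 card7; have := le3 true; have := le3 false.
by case: s; lia.
Qed.

(** Two common neighbours of the same sign would form a transitive tournament of order 4 with [x]
    and [y]. *)
Lemma card_nbrI s x y : x != y -> #|nbr s x :&: nbr s y| <= 1.
Proof.
move=> xy; apply/card_le1_eqP => a b; rewrite !inE.
wlog axy : x y {xy} / arc x y.
  move=> IH; have /orP[] := tourT xy => /IH// + /andP[? ?] /andP[? ?].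
  by apply; apply/andP.
move=> aN bN; apply: contraTeq isT => ab.
have two (c d : T) : arc c d ->
    ~ [&& if s then arc x c else arc c x, if s then arc y c else arc c y,
      if s then arc x d else arc d x & if s then arc y d else arc d y].
  move=> cd; case: (s) => /and4P[h1 h2 h3 h4].
    by apply: (@free_pairwise [:: x; y; c; d]) => //=; rewrite axy h1 h2 h3 h4 cd.
  by apply: (@free_pairwise [:: c; d; x; y]) => //=; rewrite axy h1 h2 h3 h4 cd.
have /orP[/two|/two] := tourT ab; case/andP: aN => -> ->; case/andP: bN => -> -> //.
Qed.

(** Two neighbours of [u] have at least 3 + 3 - 1 = 5 neighbours of sign [s2] in all; among 7
    vertices these must meet the 3 neighbours of [v]. *)
Lemma nbr_walk3 s1 s2 s3 u v :
  exists a b, [/\ a \in nbr s1 u, b \in nbr s2 a & b \in nbr s3 v].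
Proof.
have /card_gt1P[a [a' [aN a'N aa']]] : 1 < #|nbr s1 u| by rewrite card_nbr.
have : 0 < #|(nbr s2 a :|: nbr s2 a') :&: nbr s3 v|.
  have := cardsUI (nbr s2 a) (nbr s2 a'); rewrite !card_nbr.
  have := cardsUI (nbr s2 a :|: nbr s2 a') (nbr s3 v); rewrite !card_nbr.
  have := card_nbrI s2 aa'.
  have : #|nbr s2 a :|: nbr s2 a' :|: nbr s3 v| <= 7 by rewrite -card7 max_card.
  lia.
case/card_gt0P => b; rewrite inE in_setU => /andP[/orP[bN|bN] bv].
  by exists a, b.
by exists a', b.
Qed.

End Tournament.

(** * Critical graphs and their growth *)

Definition nbh (V : finType) (e : rel V) (x : V) : {set V} := [set y | e x y].

Section Critical.
Variables H T : ograph.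
Hypotheses (tourT : is_tournament T)
  (freeT : ~ contains T (transitive_tournament 4)) (card7 : #|T| = 7).
Hypothesis nohom : ~ exists f : H -> T, is_hom f.
Hypothesis critH :
  forall B : {set H}, B != setT -> exists f, hom_on (T := T) B f.

Lemma critical_nonempty : exists x : H, true.
Proof.
have [x _|H0] := pickP H; first by exists x.
case: nohom; exists (fun x => False_rect T (notF (esym (H0 x)))) => x.
by have := H0 x.
Qed.

(** A vertex with at most one neighbour could be coloured last, since every colour has in- and
    out-neighbours in [T]. *)
Lemma critical_mindeg x : 1 < #|nbh (@uadj H) x|.
Proof.
rewrite ltnNge; apply/card_le1_eqP => only.
have [|f hf] := @critH [set~ x].
  by apply/eqP => /setP/(_ x); rewrite !inE eqxx.
have [c hc] : exists c, forall y, uadj x y -> c \in nbr (arc y x) (f y).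
  have [y xy|no] := pickP (uadj x); last first.
    by exists (f x) => y; have := no y => /= ->.
  have /card_gt0P[c cN] : 0 < #|nbr (arc y x) (f y)| by rewrite card_nbr.
  by exists c => z xz; have -> : z = y by apply: only; rewrite inE.
case: nohom; exists (fun z => if z == x then c else f z) => u v uv.
case: (eqVneq u x) => [ux|ux]; case: (eqVneq v x) => [vx|vx].
- by rewrite ux vx arc_irr in uv.
- have := hc v; rewrite -ux /uadj uv => /(_ isT).
  by rewrite inE (negbTE (arc_asym uv)).
- by have := hc u; rewrite -vx /uadj uv orbT => /(_ isT); rewrite inE.
- by apply: hf; rewrite // !inE.
Qed.

(** Otherwise delete both ends, map the rest, and let [nbr_walk3] colour the inner vertices of the
    path [u], [x], [y], [v]. *)
Lemma critical_deg2_indep x y : uadj x y ->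
  2 < #|nbh (@uadj H) x| \/ 2 < #|nbh (@uadj H) y|.
Proof.
move=> xy; have yx : uadj y x by rewrite uadjC.
have [|degx] := ltnP 2 #|nbh (@uadj H) x|; first by left.
have [|degy] := ltnP 2 #|nbh (@uadj H) y|; first by right.
have xNy : x != y by apply: contraTneq xy => ->; rewrite uadj_irr.
have other (a b : H) : #|nbh (@uadj H) a| <= 2 -> uadj a b ->
    exists2 u, u != b & forall z, uadj a z -> z != b -> z = u.
  move=> dega ab; have := critical_mindeg a; rewrite (cardsD1 b) inE ab => dega1.
  have /card_gt0P[u] : 0 < #|nbh (@uadj H) a :\ b| by lia.
  have : #|nbh (@uadj H) a :\ b| <= 1 by rewrite (cardsD1 b) inE ab in dega; lia.
  move=> /card_le1_eqP only uN; exists u.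
    by move: uN; rewrite !inE => /andP[].
  by move=> z az zb; apply: only => //; rewrite !inE zb.
have [u uNy uP] := other x y degx xy.
have [v vNx vP] := other y x degy yx.
have [|f hf] := @critH (~: [set x; y]).
  by apply/eqP => /setP/(_ x); rewrite !inE eqxx.
(* The signs record the orientations of the three edges, the last one as seen from [v]. *)
have [a [b [aN bN bv]]] :=
  nbr_walk3 tourT freeT card7 (arc u x) (arc x y) (arc v y) (f u) (f v).
case: nohom; exists (fun z => if z == x then a else if z == y then b else f z).
move=> s t st.
case: (eqVneq s x) => [sx|sx]; case: (eqVneq t x) => [tx|tx].
- by rewrite sx tx arc_irr in st.
- have xt : arc x t by rewrite -sx.
  case: (eqVneq t y) => [ty|ty]; first by move: bN; rewrite inE -ty xt.
  have eu : t = u by apply: uP; rewrite // /uadj xt.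
  by move: aN; rewrite inE -eu (negbTE (arc_asym xt)).
- have sx' : arc s x by rewrite -tx.
  case: (eqVneq s y) => [sy|sy].
    by move: bN; rewrite inE -sy (negbTE (arc_asym sx')).
  have eu : s = u by apply: uP; rewrite // /uadj sx' orbT.
  by move: aN; rewrite inE -eu sx'.
- case: (eqVneq s y) => [sy|sy]; case: (eqVneq t y) => [ty|ty].
  + by rewrite sy ty arc_irr in st.
  + have yt : arc y t by rewrite -sy.
    have ev : t = v by apply: vP; rewrite // /uadj yt.
    by move: bv; rewrite inE -ev (negbTE (arc_asym yt)).
  + have sy' : arc s y by rewrite -ty.
    have ev : s = v by apply: vP; rewrite // /uadj sy' orbT.
    by move: bv; rewrite inE -ev sy'.
  + by apply: hf; rewrite // !inE negb_or ?sx ?tx.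
Qed.

End Critical.

(** Double counting: each vertex of [L] lies in at most one of the sets [C i]. *)
Lemma leq_sum_disjoint (I V : finType) (W : {set I}) (C : I -> {set V})
    (L : {set V}) (F : V -> nat) :
  {in W, forall i, C i \subset L} ->
  {in W &, forall i j x, x \in C i -> x \in C j -> i = j} ->
  \sum_(i in W) \sum_(x in C i) F x <= \sum_(x in L) F x.
Proof.
move=> CL disj; rewrite (eq_bigr (fun i => \sum_(x in L) (x \in C i) * F x)).
  rewrite exchange_big; apply: leq_sum => x xL /=.
  rewrite -big_distrl /= -[leqRHS]mul1n leq_mul2r; apply/orP; right.
  rewrite (sum_bool_card W (fun i => x \in C i)).
  by apply/card_le1_eqP => i j; rewrite !inE => /andP[iW xi] /andP[jW xj];
    apply: (disj j i jW iW x).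
move=> i iW; rewrite (eq_bigl (fun x => (x \in L) && (x \in C i))).
  by rewrite big_mkcondr; apply: eq_bigr => x _; case: ifP; rewrite ?mul1n.
by move=> x; case: (boolP (x \in C i)) => [/(subsetP (CL i iW))->|]; rewrite ?andbF.
Qed.

(** * Growth of spheres under large girth *)

Section Growth.
Variables (V : finType) (e : rel V).
Hypotheses (symE : symmetric e) (irrE : irreflexive e).
Variable g : nat.
Hypothesis girthE : forall c, ucycle e c -> 3 <= size c -> g < size c.

Fixpoint eball (r : V) n : {set V} :=
  if n is n'.+1 then eball r n' :|: \bigcup_(x in eball r n') nbh e x
  else [set r].

Lemma eball_sub r m n : m <= n -> eball r m \subset eball r n.
Proof.
move=> /subnK <-; elim: (n - m) => //= k IHk.
exact: subset_trans IHk (subsetUl _ _).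
Qed.

Lemma eball_step r n x y : x \in eball r n -> e x y -> y \in eball r n.+1.
Proof.
by move=> xB xy; rewrite in_setU; apply/orP/or_intror/bigcupP; exists x; rewrite ?inE.
Qed.

(** Walk towards the root: after [x] all vertices lie in the ball of radius [n - 1], which misses
    [v]. *)
Lemma eball_walk r n x v : x \in eball r n -> x != v -> v \notin eball r n.-1 ->
  exists p, [/\ path e x p, last x p = r, size p <= n & v \notin x :: p].
Proof.
elim: n x => [|n IHn] x.
  rewrite inE => /eqP-> rv _; exists [::]; split=> //.
  by rewrite inE eq_sym.
rewrite in_setU => /orP[xB xv vB|/bigcupP[y yB]].
  have [|p [pp lp sp vp]] := IHn x xB xv.
    by apply: contra vB; apply/subsetP/eball_sub/leq_pred.
  by exists p; split=> //; apply: leqW.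
rewrite inE => yx xv vB.
have [| |p [pp lp sp vp]] := IHn y yB.
- by apply: contraNneq vB => <-.
- by apply: contra vB; apply/subsetP/eball_sub/leq_pred.
by exists (y :: p); split; rewrite ?[in path _ _ _]/= ?(symE x) ?yx // inE negb_or eq_sym xv.
Qed.

(* Otherwise the walks to the root of the ball from two such neighbours,
   which avoid v, would close up to a cycle of length at most [2 n + 2]. *)
Lemma eball_parent r n v w1 w2 : n.*2.+2 <= g -> v \notin eball r n.-1 ->
  w1 \in eball r n -> w2 \in eball r n -> e v w1 -> e v w2 -> w1 = w2.
Proof.
move=> ng vB w1B w2B vw1 vw2; apply: contraTeq isT => w12.
have neq w : e v w -> w != v by apply: contraTneq => ->; rewrite irrE.
have [p1 [pp1 lp1 sp1 vp1]] := eball_walk w1B (neq _ vw1) vB.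
have [p2 [pp2 lp2 sp2 vp2]] := eball_walk w2B (neq _ vw2) vB.
(* Both walks end at the root; [belast] drops its second copy when the second walk is reversed. *)
pose q := p1 ++ rev (belast w2 p2).
have pq : path e w1 q.
  rewrite cat_path pp1 lp1 -lp2 rev_path /=.
  by rewrite (eq_path (e' := e)) // => x y; rewrite symE.
have lq : last w1 q = w2.
  rewrite last_cat lp1; case: (p2) lp2 => [|y p'] /=; first by move->.
  by rewrite rev_cons last_rcons.
have vq : v \notin w1 :: q.
  rewrite -cat_cons mem_cat negb_or vp1 mem_rev.
  by apply: contra vp2; apply: mem_belast.
have sq : size q <= n.*2 by rewrite size_cat size_rev size_belast -addnn leq_add.
move: lq vq sq; case/shortenP: pq => q' pq' uq' sub lq' vq sq.
have := girthE (c := v :: w1 :: q'); rewrite /ucycle /= vw1 rcons_path pq' lq' symE vw2.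
rewrite -[_ && uniq _]/(uniq (w1 :: q')) uq' andbT.
have -> : v \notin w1 :: q'.
  move: vq; rewrite !inE !negb_or => /andP[-> vq] /=.
  by apply: contra vq; apply: sub.
have sq' : size q' <= size q by apply: uniq_leq_size sub; case/andP: uq'.
have q'0 : q' != [::] by apply: contra_neq w12 => q'0; rewrite -lq' q'0.
case: (q') q'0 sq' => //= y q'' _ sq' /(_ isT isT); rewrite ltnNge => /negP[].
by apply: leq_trans ng; rewrite !ltnS; apply: leq_trans sq' sq.
Qed.

Hypothesis mindegE : forall x, 1 < #|nbh e x|.
Hypothesis deg2E : forall x y, e x y -> 2 < #|nbh e x| \/ 2 < #|nbh e y|.

Section Levels.
Variable r : V.

(** The index is shifted: [level j] is the sphere of radius [j + 1]. *)
Let level j := eball r j.+1 :\: eball r j.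
Let children j v := nbh e v :\: eball r j.+1.

(** By [eball_parent], at most one neighbour of [v] lies in the ball of radius [j + 1]. *)
Lemma card_children j v : j.*2.+4 <= g -> v \in level j ->
  #|nbh e v|.-1 <= #|children j v|.
Proof.
move=> jg; rewrite inE => /andP[vN _].
rewrite -(cardsID (eball r j.+1) (nbh e v)) -subn1 leq_subLR leq_add2r.
apply/card_le1_eqP => x y; rewrite !in_setI => /andP[vx xB] /andP[vy yB].
rewrite !inE in vx vy.
by apply: (@eball_parent r j.+1 v) => //; rewrite ?doubleS.
Qed.

Lemma children_level j v : v \in level j -> children j v \subset level j.+1.
Proof.
rewrite inE => /andP[_ vB]; apply/subsetP => x.
by rewrite !in_setD => /andP[-> vx]; apply: eball_step vB _; rewrite inE in vx.
Qed.

Lemma children_disjoint j : j.*2.+4 <= g ->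
  {in level j &, forall v w x, x \in children j v -> x \in children j w -> v = w}.
Proof.
move=> jg v w; rewrite !in_setD => /andP[_ vB] /andP[_ wB] x.
rewrite !in_setD => /andP[xB xv] /andP[_ xw]; rewrite !inE in xv xw.
apply: (@eball_parent r j.+1 x); rewrite ?doubleS // 1?symE //.
by apply: contra xB; apply/subsetP/eball_sub.
Qed.

(** Each [v] in [level j] has at least two grandchildren: if its degree is at least 3, it has two
    children with a child each; otherwise it has a child of degree at least 3. *)
Lemma level_double j : j.*2.+2.+4 <= g -> #|level j|.*2 <= #|level j.+2|.
Proof.
move=> jg; have jg' : j.*2.+4 <= g by apply: ltnW (ltnW jg).
have jg1 : j.+1.*2.+4 <= g by rewrite doubleS.
rewrite -[#|level j.+2|]sum1_card.
apply: leq_trans (leq_sum_disjoint (fun=> 1) (@children_level j.+1) (children_disjoint jg1)).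
apply: (@leq_trans (\sum_(w in level j.+1) #|nbh e w|.-1)); last first.
  by apply: leq_sum => w wL; rewrite sum1_card card_children.
apply: leq_trans (leq_sum_disjoint _ (@children_level j) (children_disjoint jg')).
rewrite -muln2 -sum_nat_const; apply: leq_sum => v vL.
have := card_children jg' vL; case: (ltnP 2 #|nbh e v|) => [deg3 le_ch|deg2 le_ch].
  apply: (@leq_trans #|children j v|).
    by apply: leq_trans le_ch; case: #|_| deg3.
  rewrite -sum1_card; apply: leq_sum => w _.
  by have := mindegE w; case: #|_|.
have /card_gt0P[w wC] : 0 < #|children j v|.
  by apply: leq_trans le_ch; have := mindegE v; case: #|_|.
have vw : e v w by move: wC; rewrite in_setD [w \in nbh _ _]inE => /andP[].
rewrite (bigD1 w) //=; apply: leq_trans (leq_addr _ _).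
have [deg3|] := deg2E vw; first by rewrite ltnNge deg2 in deg3.
by case: #|_|.
Qed.

(** Only every other sphere is counted: the smaller ball and the new sphere contribute equal bounds,
    so their sum doubles. The added 2 turns the 1 + 3 vertices of the first ball into 6. *)
Lemma eball_growth i : 2 < #|nbh e r| -> i.*2.*2.+4 <= g ->
  3 * 2 ^ i <= #|level i.*2| /\ 3 * 2 ^ i.+1 <= #|eball r i.*2.+1|.+2.
Proof.
move=> deg3; elim: i => [|i IHi] ig.
  have rN : r \notin nbh e r by rewrite inE irrE.
  have L0 : level 0 = nbh e r.
    apply/setP => x; rewrite in_setD in_setU big_set1 in_set1.
    by case: (eqVneq x r) => [->|_]; rewrite ?(negbTE rN).
  split; first by rewrite L0.
  by rewrite /= big_set1 cardsU1 rN add1n; exact: deg3.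
have [|IHl IHb] := IHi; first by move: ig; clear; lia.
have dbl : 3 * 2 ^ i.+1 <= #|level i.+1.*2|.
  have ig' : i.*2.*2.+2.+4 <= g by move: ig; clear; lia.
  apply: leq_trans (level_double ig'); rewrite expnS mulnCA -mul2n.
  by rewrite leq_mul2l IHl.
split=> //; rewrite [in leqLHS]expnS mulnCA mul2n -addnn.
have -> : #|eball r i.+1.*2.+1| = #|eball r i.+1.*2| + #|level i.+1.*2|.
  rewrite -(cardsID (eball r i.+1.*2) (eball r i.+1.*2.+1)); congr (_ + _).
  by rewrite (setIidPr _) // eball_sub.
have le1 : #|eball r i.*2.+1| <= #|eball r i.+1.*2|.
  by apply/subset_leq_card/eball_sub; rewrite doubleS.
have le2 : 3 * 2 ^ i.+1 <= #|eball r i.+1.*2|.+2 by apply: leq_trans IHb _.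
exact: leq_add le2 dbl.
Qed.

End Levels.

Lemma girth_growth : 4 <= g -> (exists x : V, true) ->
  3 * 2 ^ (g %/ 4) - 2 <= #|V|.
Proof.
move=> g4 [x _].
have [r deg3] : exists r, 2 < #|nbh e r|.
  have /card_gt0P[y] : 0 < #|nbh e x| by apply: ltnW.
  by rewrite inE => /deg2E[]; [exists x|exists y].
(* The largest index [i] with [4 * i + 4 <= g]. *)
have [|_] := @eball_growth r (g %/ 4).-1 deg3.
  by rewrite -!muln2; lia.
rewrite prednK ?divn_gt0 // leq_subLR add2n => le3.
by apply: leq_trans le3 _; rewrite !ltnS max_card.
Qed.

End Growth.

(** * Graphs of compressibility 8 and the Paley tournament of order 7 *)

Lemma hom_comp (G H K : ograph) (f : G -> H) (h : H -> K) :
  is_hom f -> is_hom h -> is_hom (h \o f).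
Proof. by move=> hf hh x y /hf/hh. Qed.

Lemma induced_val_hom (H : ograph) (A : {set H}) :
  is_hom (fun x : induced A => val x).
Proof. by []. Qed.

Lemma acyclic_hom_tournament p (H T : ograph) :
  acyclic H -> pathnum H <= p.+1 -> is_tournament T -> 2 ^ p <= #|T| ->
  exists f : H -> T, is_hom f.
Proof.
move=> acH pH tT /(contains_transitive tT)[h _ hh].
have [f hf] := hom_transitive acH pH.
by exists (h \o f); apply: hom_comp hf hh.
Qed.

Lemma compressibility8_order (g : nat) (H : ograph) :
  4 <= g -> acyclic H -> pathnum H = 4 -> compressibility H = 8 ->
  girth_gt H g -> 3 * 2 ^ (g %/ 4) - 2 <= #|H|.
Proof.
move=> g4 acH pH cH gH.
have [T [tT T7 noT]] : exists T : ograph, [/\ is_tournament T, #|T| = 7 &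
    ~ exists f : H -> T, is_hom f].
  apply: contrapT => no; suff [_ le7] : 0 < 8 /\ compressibility H <= 7.
    by rewrite cH in le7.
  split=> //; apply: (proj2 (leastP _)); split=> // T tT T7.
  by apply: contrapT => noT; apply: no; exists T.
have free : ~ contains T (transitive_tournament 4).
  case=> h _ hh; have [|f hf] := @hom_transitive _ acH 4; first by rewrite pH.
  by apply: noT; exists (h \o f); apply: hom_comp hf hh.
have /card_gt0P[t _] : 0 < #|T| by rewrite T7.
have [A [nohom crit]] := critical_subgraph t noT.
apply: (@leq_trans #|induced A|); last by rewrite card_induced max_card.
apply: (@girth_growth _ (@uadj (induced A))) => //.
- exact: uadjC.
- exact: uadj_irr.
- by apply/girth_gtP/girth_induced.
- by move=> x; apply: (critical_mindeg tT free T7 nohom crit).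
- by move=> x y; apply: (critical_deg2_indep tT free T7 nohom crit).
- exact: (critical_nonempty nohom).
Qed.

(* The arcs of the Paley tournament on 7 vertices: 1, 2 and 4 are the nonzero
   squares modulo 7. *)
Definition paley_arc : rel 'I_7 := fun i j => (j + (7 - i)) %% 7 \in [:: 1; 2; 4].

Lemma ord_allP n (P : pred nat) : all P (iota 0 n) -> forall i : 'I_n, P i.
Proof. by move=> /allP allP i; apply: allP; rewrite mem_iota /=. Qed.

Fact paley_irr : irreflexive paley_arc.
Proof.
move=> i; apply/negbTE; move: i.
by apply: (@ord_allP 7 (fun i => (i + (7 - i)) %% 7 \notin [:: 1; 2; 4])).
Qed.

(** As -1 is not a square modulo 7, exactly one of a nonzero difference and its opposite is a
    square; all pairs are evaluated. *)
Fact paley_total_asym (i j : 'I_7) : i != j -> paley_arc i j = ~~ paley_arc j i.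
Proof.
have chk : all (fun i => all (fun j => (i != j) ==>
    (((j + (7 - i)) %% 7 \in [:: 1; 2; 4]) == ((i + (7 - j)) %% 7 \notin [:: 1; 2; 4])))
    (iota 0 7)) (iota 0 7) by [].
by move=> ij; apply/eqP; apply: implyP (ord_allP (ord_allP chk i) j) ij.
Qed.

Fact paley_asym i j : paley_arc i j -> ~~ paley_arc j i.
Proof.
move=> ij; rewrite -paley_total_asym //.
by apply: contraTneq ij => ->; rewrite paley_irr.
Qed.

Definition paley : ograph := OGraph paley_irr paley_asym.

Lemma paley_tournament : is_tournament paley.
Proof.
by move=> i j ij; rewrite /arc /= paley_total_asym // orNb.
Qed.

Lemma paley_free4 : ~ contains paley (transitive_tournament 4).
Proof.
case=> f _ homf; pose q i j := (j + (7 - i)) %% 7 \in [:: 1; 2; 4].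
(* Arc conditions are tested as soon as their ends are chosen, which prunes the search over
   quadruples. *)
have chk : all (fun a => all (fun b => q a b ==> all (fun c => q a c && q b c ==>
    all (fun d => ~~ [&& q a d, q b d & q c d]) (iota 0 7)) (iota 0 7)) (iota 0 7))
  (iota 0 7) by [].
have arcf i j (i4 : i < 4) (j4 : j < 4) : i < j -> q (f (Ordinal i4)) (f (Ordinal j4)).
  by move=> ij; apply: homf.
have arc2 i j k (i4 : i < 4) (j4 : j < 4) (k4 : k < 4) : i < k -> j < k ->
    q (f (Ordinal i4)) (f (Ordinal k4)) && q (f (Ordinal j4)) (f (Ordinal k4)).
  by move=> ik jk; rewrite !arcf.
have chk2 := implyP (ord_allP (ord_allP chk (f (@Ordinal 4 0 isT)))
  (f (@Ordinal 4 1 isT))) (arcf 0 1 isT isT isT).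
have chk3 := implyP (ord_allP chk2 (f (@Ordinal 4 2 isT))) (arc2 0 1 2 isT isT isT isT isT).
have /negP[] := ord_allP chk3 (f (@Ordinal 4 3 isT)).
by apply/and3P; split; apply: arcf.
Qed.

(** Showing that a least order is 8 requires a counterexample for every smaller order;
    subtournaments of [paley] provide them. *)
Lemma subpaley n : n < 8 -> exists T : ograph,
  [/\ is_tournament T, #|T| = n & exists2 f : T -> paley, injective f & is_hom f].
Proof.
move=> n8; exists (@induced paley [set i : 'I_7 | i < n]); split.
- by move=> x y xy; apply: (@paley_tournament (val x) (val y)).
- rewrite card_induced; have -> : [set i : 'I_7 | i < n] = [set widen_ord (n8 : n <= 7) i | i : 'I_n].
    apply/setP => i; rewrite inE; apply/idP/imsetP => [lt_in|[j _ ->]]; last exact: (ltn_ord j).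
    by exists (Ordinal lt_in) => //; apply: val_inj.
  by rewrite card_imset ?card_ord // => i j /(congr1 val) /= /val_inj.
- by exists val; [apply: val_inj|apply: induced_val_hom].
Qed.

Lemma least_eq (P : nat -> Prop) n :
  P n -> (forall m, m < n -> ~ P m) -> least P = n.
Proof.
move=> Pn minP; have [Pl le_n] := leastP Pn; apply/eqP.
rewrite eqn_leq le_n leqNgt; apply/negP => lt_n.
exact: minP lt_n Pl.
Qed.

Lemma r_tr4 : r_tr 4 = 8.
Proof.
apply: least_eq => [T tT T8|m m8 Pm].
  by apply: (@contains_transitive _ tT 3); rewrite T8.
have [T [tT Tm [f injf homf]]] := subpaley m8.
have [h injh homh] := Pm T tT Tm; apply: paley_free4.
by exists (f \o h); [apply: inj_comp|apply: hom_comp homh homf].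
Qed.

Lemma compressibility_eq8 (H : ograph) : acyclic H -> pathnum H <= 4 ->
  ~ (exists f : H -> paley, is_hom f) -> compressibility H = 8.
Proof.
move=> acH pH nohom; apply: least_eq => [|m m8 [_ Pm]].
  by split=> // T tT T8; apply: (@acyclic_hom_tournament 3); rewrite ?T8.
have [T [tT Tm [f _ homf]]] := subpaley m8.
have [h homh] := Pm T tT Tm; apply: nohom.
by exists (f \o h); apply: hom_comp homh homf.
Qed.

(** With at most three vertices on each path, [H] would map to the transitive tournament of order 3,
    which any tournament on at least 4 vertices contains. *)
Lemma pathnum_eq4 (H : ograph) : acyclic H -> pathnum H <= 4 ->
  ~ (exists f : H -> paley, is_hom f) -> pathnum H = 4.
Proof.
move=> acH pH nohom; apply/eqP; rewrite eqn_leq pH leqNgt; apply/negP => p3.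
apply: nohom; apply: (@acyclic_hom_tournament 2) => //; first exact: paley_tournament.
by rewrite card_ord.
Qed.

(** * Cliques and girth *)

Lemma linkedP (H : ograph) (x y : H) : linked arc x y -> uadj x y \/
  exists2 z, uadj x z && uadj z y & (arc x z && arc z y) || (arc y z && arc z x).
Proof.
rewrite /linked /uadj => /or4P[->|->|/existsP[z]|/existsP[z]].
- by left.
- by left; rewrite orbT.
- by move=> /andP[xz zy]; right; exists z; rewrite xz zy.
- by move=> /andP[yz zx]; right; exists z; rewrite yz zx !orbT.
Qed.

Section CliqueNumbers.
Variable H : ograph.
Hypothesis gH : girth_gt H 6.

Lemma no_short_cycle (c : seq H) : cycle (@uadj H) c -> uniq c -> 2 < size c < 7 -> False.
Proof.
move=> cc uc /andP[c3 c7]; have /girth_gtP/(_ c) := gH.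
by rewrite /ucycle cc uc => /(_ isT c3); rewrite ltnNge -ltnS c7.
Qed.

Lemma uadj_neq (x y : H) : uadj x y -> x != y.
Proof. by apply: contraTneq => ->; rewrite uadj_irr. Qed.

Lemma no_C3 (x y z : H) : uadj x y -> uadj y z -> uadj z x -> False.
Proof.
move=> xy yz zx; apply: (@no_short_cycle [:: x; y; z]) => //=; first by rewrite xy yz zx.
by rewrite !inE !negb_or (uadj_neq xy) (uadj_neq yz) eq_sym (uadj_neq zx).
Qed.

Lemma no_C4 (x y z w : H) : uadj x y -> uadj y z -> uadj z w -> uadj w x ->
  x != z -> y != w -> False.
Proof.
move=> xy yz zw wx xz yw; apply: (@no_short_cycle [:: x; y; z; w]) => //=.
  by rewrite xy yz zw wx.
by rewrite !inE !negb_or (uadj_neq xy) (uadj_neq yz) (uadj_neq zw) xz yw eq_sym (uadj_neq wx).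
Qed.

(** A closed walk of length 5 with a repeated vertex would contain a triangle, so the five vertices
    are distinct. *)
Lemma no_C5 (x y z w v : H) : uadj x y -> uadj y z -> uadj z w -> uadj w v ->
  uadj v x -> False.
Proof.
move=> xy yz zw wv vx.
have ne (a c d f : H) : uadj c d -> uadj d f -> uadj f a -> a != c.
  by move=> cd df; apply: contraTneq => ->; apply/negP => /(no_C3 cd df).
apply: (@no_short_cycle [:: x; y; z; w; v]) => //=.
  by rewrite xy yz zw wv vx.
have x_v : x != v by rewrite eq_sym uadj_neq.
have x_w : x != w by rewrite eq_sym (ne w x y z).
have y_v : y != v by rewrite eq_sym (ne v y z w).
rewrite !inE !negb_or (uadj_neq xy) (uadj_neq yz) (uadj_neq zw) (uadj_neq wv).
by rewrite x_v x_w y_v (ne x z w v) // (ne y w v x) // (ne z v x y).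
Qed.

Section Linked.
Variable S : {set H}.
Hypothesis linkS : pairwise_linked arc S.

Lemma link x y : x \in S -> y \in S -> x != y -> linked arc x y.
Proof.
move=> xS yS; move/forall_inP: linkS => /(_ x xS)/forall_inP/(_ y yS)/implyP.
exact.
Qed.

(** Triangles and 4-cycles being excluded, the directed path linking [x] and [y] passes through [m]:
    one arc enters [m], the other leaves it. *)
Lemma linked_through m x y : x \in S -> y \in S -> x != y ->
  uadj x m -> uadj y m -> arc x m != arc y m.
Proof.
move=> xS yS xy xm ym; have [xy'|[z /andP[xz zy]]] := linkedP (link xS yS xy).
  by case: (no_C3 xm (_ : uadj m y) (_ : uadj y x)); rewrite uadjC.
have -> : z = m.
  apply/eqP; apply: contraT => zm.
  by case: (no_C4 xz zy ym (_ : uadj m x)) => //; rewrite uadjC.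
case/orP => /andP[h1 h2]; first by rewrite h1 (negbTE (arc_asym h2)).
by rewrite h1 (negbTE (arc_asym h2)).
Qed.

Lemma linked_star m x y z : x \in S -> y \in S -> z \in S ->
  x != y -> y != z -> x != z -> uadj x m -> uadj y m -> uadj z m -> False.
Proof.
move=> xS yS zS xy yz xz xm ym zm.
have := linked_through xS yS xy xm ym; have := linked_through yS zS yz ym zm.
by have := linked_through xS zS xz xm zm; do 3!case: arc.
Qed.

(** Take the midpoints of the three linking paths: if two coincide they give a star, otherwise a
    6-cycle arises. *)
Lemma linked_nonadjacent x y z : x \in S -> y \in S -> z \in S ->
  x != y -> y != z -> x != z -> ~~ uadj x y -> ~~ uadj y z -> ~~ uadj x z -> False.
Proof.
move=> xS yS zS xy yz xz nxy nyz nxz.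
have mid (u v : H) : u \in S -> v \in S -> u != v -> ~~ uadj u v ->
    exists2 m, uadj u m & uadj v m.
  move=> uS vS uv nuv; have [uv'|[m /andP[um mv] _]] := linkedP (link uS vS uv).
    by rewrite uv' in nuv.
  by exists m; rewrite // uadjC.
have [p xp yp] := mid x y xS yS xy nxy.
have [q yq zq] := mid y z yS zS yz nyz.
have [r xr zr] := mid x z xS zS xz nxz.
have [eq_pq|pq] := eqVneq p q.
  by apply: (linked_star xS yS zS xy yz xz xp yp); rewrite eq_pq.
have [eq_pr|pr] := eqVneq p r.
  by apply: (linked_star xS yS zS xy yz xz xp yp); rewrite eq_pr.
have [eq_qr|qr] := eqVneq q r.
  by apply: (linked_star xS yS zS xy yz xz _ yq zq); rewrite eq_qr.
apply: (@no_short_cycle [:: x; p; y; q; z; r]) => //=.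
  by rewrite xp yq zr (uadjC p) yp (uadjC q) zq (uadjC r) xr.
have ne (u v w : H) : uadj v w -> ~~ uadj v u -> u != w.
  by move=> vw; apply: contraNneq => ->.
have p_z : p != z by rewrite eq_sym (ne z x p).
have p_y : p != y by rewrite eq_sym uadj_neq.
have q_z : q != z by rewrite eq_sym uadj_neq.
have x_q : x != q by apply: (ne x y q); rewrite // uadjC.
rewrite !inE !negb_or pq pr qr xy yz xz (uadj_neq xp) (uadj_neq xr) (uadj_neq yq).
by rewrite (uadj_neq zr) x_q p_z p_y q_z (ne y x r).
Qed.

(** Otherwise the paths linking [z] to [x] and to [y] close a cycle of length 5 with the edge. *)
Lemma linked_edge x y z : x \in S -> y \in S -> z \in S ->
  x != z -> y != z -> uadj x y -> uadj x z || uadj y z.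
Proof.
move=> xS yS zS xz yz xy; have [//|[p /andP[xp pz] _]] := linkedP (link xS zS xz).
  by move->.
have [->|[q /andP[yq qz] _]] := linkedP (link yS zS yz); first by rewrite orbT.
by case: (no_C5 xy yq qz (_ : uadj z p) (_ : uadj p x)); rewrite uadjC.
Qed.

(** Both [z] and [w] attach to the edge: at the same end they form a star; at different ends the
    link between them closes a cycle of length 4 or 5. *)
Lemma linked_edge4 x y z w : x \in S -> y \in S -> z \in S -> w \in S ->
  uniq [:: x; y; z; w] -> uadj x y -> False.
Proof.
move=> xS yS zS wS /=; rewrite !inE !negb_or => /and4P[/and3P[xy xz xw] /andP[yz yw] zw _] axy.
have cross (u v s t : H) : u \in S -> v \in S -> s \in S -> t \in S -> uadj u v ->
    v != s -> u != t -> s != t -> uadj u s -> uadj v t -> False.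
  move=> uS vS sS tS uv vs ut st us vt.
  have [ast|[p /andP[sp pt] _]] := linkedP (link sS tS st).
    by apply: (no_C4 (_ : uadj s u) uv vt (_ : uadj t s)); rewrite // 1?uadjC // eq_sym.
  by apply: (no_C5 (_ : uadj s u) uv vt (_ : uadj t p) (_ : uadj p s)); rewrite uadjC.
have /orP[xz'|yz'] := linked_edge xS yS zS xz yz axy;
have /orP[xw'|yw'] := linked_edge xS yS wS xw yw axy.
- by apply: (@linked_star x y z w); rewrite // uadjC.
- exact: (cross x y z w).
- by apply: (cross x y w z); rewrite // eq_sym.
- by apply: (@linked_star y x z w); rewrite // uadjC.
Qed.

Lemma card_pairwise_linked : #|S| <= 3.
Proof.
rewrite leqNgt; apply/negP => S4.
have /card_gt2P[x [y [z [[xS yS zS] [xy yz zx]]]]] : 2 < #|S| by apply: ltnW.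
have /subsetPn[w wS] : ~~ (S \subset [set x; y; z]).
  apply: contraL S4 => /subset_leq_card le; rewrite -leqNgt (leq_trans le) //.
  by rewrite -setUA !cardsU1 cards1; case: (_ \notin _); case: (_ \notin _).
rewrite !inE !negb_or -andbA => /and3P[wx wy wz].
have edge4 (u v s : H) : u \in S -> v \in S -> s \in S -> uniq [:: u; v; s] ->
    w \notin [:: u; v; s] -> ~~ uadj u v.
  move=> uS vS sS uu uw; apply/negP; apply: (@linked_edge4 u v s w) => //.
  by have := rcons_uniq [:: u; v; s] w; rewrite uu uw.
have xz : x != z by rewrite eq_sym.
apply: (linked_nonadjacent xS yS zS xy yz xz).
- by apply: (edge4 x y z); rewrite //= !inE !negb_or ?xy ?yz ?xz ?wx ?wy ?wz.
- by apply: (edge4 y z x); rewrite //= !inE !negb_or ?[y == x]eq_sym ?xy ?yz ?zx ?wx ?wy ?wz.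
- by apply: (edge4 x z y); rewrite //= !inE !negb_or ?[z == y]eq_sym ?xy ?yz ?xz ?wx ?wy ?wz.
Qed.

End Linked.

Lemma pathnum_witness : exists2 s : seq H, dipath s & size s = pathnum H.
Proof.
have nil0 : [exists s : 0.-tuple H, dipath s].
  by apply/existsP; exists [tuple].
have [|i /existsP[s ds] hi] := @eq_bigmax_cond _ [pred n : 'I_#|H|.+1 |
    [exists s : n.-tuple H, dipath s]] val.
  by apply/card_gt0P; exists ord0; rewrite inE.
by exists s; rewrite // /pathnum hi size_tuple.
Qed.

Lemma omega_ao_ro : omega_ao H <= omega_ro H.
Proof.
apply/bigmax_leqP => S /existsP[A /andP[/forall_inP subA linkA]].
apply: (bigmax_sup S) => //; apply/forall_inP => x xS; apply/forall_inP => y yS.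
have arcA (u v : H) : (u, v) \in A -> arc u v by move=> /subA/and3P[].
apply/implyP => xy; move/forall_inP: linkA => /(_ x xS)/forall_inP/(_ y yS)/implyP/(_ xy).
rewrite /linked => /or4P[/arcA->|/arcA->|/existsP[z /andP[/arcA xz /arcA zy]]|
  /existsP[z /andP[/arcA xz /arcA zy]]]; rewrite ?orbT //.
  by apply/or4P/Or43/existsP; exists z; rewrite xz.
by apply/or4P/Or44/existsP; exists z; rewrite xz.
Qed.

(** Three consecutive vertices of a directed path form an oriented clique. *)
Lemma clique_numbers : 2 < pathnum H -> omega_ao H = 3 /\ omega_ro H = 3.
Proof.
have [s ds <-] := pathnum_witness; move=> s3.
have ro3 : omega_ro H <= 3.
  by apply/bigmax_leqP => S; apply: card_pairwise_linked.
suff ao3 : 2 < omega_ao H.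
  have := omega_ao_ro; split; apply/eqP; rewrite eqn_leq; apply/andP; split => //.
    exact: leq_trans ro3.
  exact: leq_trans omega_ao_ro.
case: s ds s3 => [|x [|y [|z s]]] //= /andP[/and3P[xy yz _]].
rewrite /= !inE !negb_or => /and4P[/and3P[x_y x_z _] /andP[y_z _] _ _] _.
apply: (bigmax_sup [set x; y; z]); last first.
  by rewrite -setUA cardsU1 !inE negb_or x_y x_z cards2 y_z.
apply/existsP; exists [set (x, y); (y, z)]; apply/andP; split.
  apply/forall_inP => u; rewrite !inE => /orP[]/eqP-> /=.
    by rewrite !eqxx xy orbT.
  by rewrite !eqxx yz !orbT.
apply/forall_inP => u uS; apply/forall_inP => v vS; apply/implyP.
have xzP : [exists t, ((x, t) \in [set (x, y); (y, z)]) && ((t, z) \in [set (x, y); (y, z)])].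
  by apply/existsP; exists y; rewrite !inE !eqxx orbT.
move: uS vS; rewrite /linked !in_setU !in_set1 -!orbA.
by move=> /or3P[]/eqP-> /or3P[]/eqP->; rewrite ?xzP ?eqxx ?orbT.
Qed.

End CliqueNumbers.

(** * A random layered graph *)

(** Sixteen independent picks all avoid an eighth of a layer with probability at most 1/8. *)
Lemma exp78 : 8 * 7 ^ 16 <= 8 ^ 16.
Proof. lia. Qed.

Lemma exp78M m : 8 ^ m * 7 ^ (16 * m) <= 8 ^ (16 * m).
Proof.
rewrite (expnM 7) (expnM 8 16); move: (7 ^ 16) (8 ^ 16) exp78 => b c bc.
by rewrite -expnMn; case: m => // m; rewrite leq_exp2r.
Qed.

(** The left side is the cyclic successor in the form that [next_nth] produces. *)
Lemma nth_cyclic_succ (T : Type) (x z : T) (c : seq T) k : k < size c ->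
  match c with [::] => z | y :: p => nth y p k end = nth x c (k.+1 %% size c).
Proof.
case: c => //= y p; rewrite ltnS leq_eqVlt => /predU1P[->|kp].
  by rewrite modnn nth_default.
by rewrite modn_small //=; apply: set_nth_default.
Qed.

Lemma leq_card_bigcup (I T : finType) (P : pred I) (F : I -> {set T}) :
  #|\bigcup_(i | P i) F i| <= \sum_(i | P i) #|F i|.
Proof.
elim/big_rec2: _ => [|i m A _ le_m]; first by rewrite cards0.
have [leU _] := leq_card_setU (F i) A.
by apply: leq_trans leU _; rewrite leq_add2l.
Qed.

Lemma card_ffun_in (S T : finType) (F : S -> {set T}) :
  #|[set phi : {ffun S -> T} | [forall s, phi s \in F s]]| = \prod_s #|F s|.
Proof.
transitivity #|finfun.family (fun s => mem (F s))|.
  by apply: eq_card => phi; rewrite inE.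
by rewrite card_family foldrE big_map big_enum.
Qed.

Lemma prod_if_const (S : finType) (D : {set S}) a b :
  \prod_s (if s \in D then a else b) = a ^ #|D| * b ^ #|~: D|.
Proof.
rewrite (bigID (mem D)) /= -!prod_nat_const; congr (_ * _).
  by apply: eq_bigr => s ->.
rewrite (eq_bigl (fun s => s \in ~: D)) => [|s]; last by rewrite inE.
by apply: eq_bigr => s; rewrite inE => /negbTE->.
Qed.

(** Distinct slots are independent; the probability bound is multiplied out to stay within natural
    numbers. *)
Lemma card_ffun_prescribed (S T : finType) l (sigma : 'I_l -> S) (y : 'I_l -> T) :
  injective sigma ->
  #|[set phi : {ffun S -> T} | [forall k, phi (sigma k) == y k]]| * #|T| ^ l
    <= #|{ffun S -> T}|.
Proof.
move=> inj; pose D := [set sigma k | k in 'I_l].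
have cD : #|D| = l by rewrite card_imset // card_ord.
apply: (@leq_trans ((\prod_s if s \in D then 1 else #|T|) * #|T| ^ l)).
  rewrite leq_mul2r; apply/orP; right.
  pose F s := [set z | [forall k, (sigma k == s) ==> (z == y k)]].
  apply: (@leq_trans #|[set phi : {ffun S -> T} | [forall s, phi s \in F s]]|).
    apply/subset_leq_card/subsetP => phi; rewrite !inE => /forallP h.
    apply/forallP => s; rewrite inE; apply/forallP => k.
    by apply/implyP => /eqP <-.
  rewrite card_ffun_in; apply: leq_prod => s _; case: ifP => [/imsetP[k _ ->]|_].
    apply/card_le1_eqP => z z'; rewrite !inE.
    by move=> /forallP/(_ k)/implyP/(_ (eqxx _))/eqP-> /forallP/(_ k)/implyP/(_ (eqxx _))/eqP->.
  exact: max_card.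
rewrite prod_if_const exp1n mul1n -expnD -{1}cD addnC cardsC.
by rewrite card_ffun.
Qed.

Lemma leq_sum_card_swap (I J : finType) (P : pred I) (Q : I -> J -> bool) :
  \sum_j #|[set i | P i && Q i j]| = \sum_(i | P i) #|[set j | Q i j]|.
Proof.
transitivity (\sum_j \sum_(i | P i) (Q i j : nat)).
  apply: eq_bigr => j _; rewrite -sum1_card big_mkcond [RHS]big_mkcond /=.
  by apply: eq_bigr => i _; rewrite inE; case: (P i); case: (Q i j).
rewrite exchange_big; apply: eq_bigr => i _; rewrite -sum1_card [RHS]big_mkcond /=.
by apply: eq_bigr => j _; rewrite inE; case: (Q i j).
Qed.

Section RandomGraph.
Variables n d N : nat.
Hypothesis defN : N = 8 * n.
Notation rvertex := ('I_4 * 'I_N)%type.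
Notation rslot := (rvertex * 'I_4 * 'I_d)%type.
Notation sample := {ffun rslot -> 'I_N}.

(* Every vertex picks [d] random vertices in each of the four layers; the picks
   that do not lie in a higher layer are ignored. *)
Definition rarc (phi : sample) : rel rvertex :=
  fun u v => (u.1 < v.1) && [exists t, phi (u, v.1, t) == v.2].

Fact rarc_irr phi : irreflexive (rarc phi).
Proof. by move=> u; rewrite /rarc ltnn. Qed.

Fact rarc_asym phi u v : rarc phi u v -> ~~ rarc phi v u.
Proof. by rewrite /rarc => /andP[uv _]; rewrite ltnNge ltnW. Qed.

Definition rgraph phi : ograph := OGraph (@rarc_irr phi) (@rarc_asym phi).

Definition unjoined (i j : 'I_4) (A B : {set 'I_N}) : {set sample} :=
  [set phi : sample | [forall a in A, forall t, phi ((i, a), j, t) \notin B]].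

(** The [128 |A|] picks all avoid [B] with probability at most [(7/8)^(128 |A|)], hence at most
    [8^(-8 |A|)], and [8 |A| >= N]. *)
Lemma card_unjoined i j (A B : {set 'I_N}) : d = 128 -> n <= #|A| -> n <= #|B| ->
  #|unjoined i j A B| * 8 ^ N <= #|{: sample}|.
Proof.
move=> d128 An Bn.
pose D : {set rslot} := [set (i, p.1, j, p.2) | p in setX A [set: 'I_d]].
have cD : #|D| = #|A| * 128.
  rewrite card_imset; first by rewrite cardsX cardsT card_ord d128.
  by move=> [a t] [a' t'] [] /= -> ->.
have le1 : #|unjoined i j A B| <= (7 * n) ^ #|D| * N ^ #|~: D|.
  rewrite -prod_if_const.
  pose F (s : rslot) := if s \in D then ~: B else setT.
  apply: (@leq_trans #|[set phi : sample | [forall s, phi s \in F s]]|).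
    apply/subset_leq_card/subsetP => phi; rewrite !inE => /forall_inP h.
    apply/forallP => s; rewrite /F; case: ifP => [/imsetP[[a t]]|_]; last by rewrite inE.
    by rewrite inE /= => /andP[/h/forallP/(_ t) aB _] ->; rewrite inE.
  rewrite card_ffun_in; apply: leq_prod => s _; rewrite /F; case: ifP => _.
    have le8 : n + #|~: B| <= N by rewrite -[leqRHS]card_ord -(cardsC B) leq_add2r.
    have := leq_trans le8 (eq_leq defN).
    by rewrite -[8]/(1 + 7) mulnDl mul1n leq_add2l.
  by rewrite cardsT card_ord.
have le2 : #|unjoined i j A B| * 8 ^ #|D| <= 7 ^ #|D| * #|{: sample}|.
  rewrite card_ffun card_ord -(cardsC D) expnD.
  move: le1; move: #|unjoined i j A B| #|D| #|~: D| => u a b le1.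
  apply: leq_trans (leq_mul le1 (leqnn _)) _.
  rewrite mulnAC [leqRHS]mulnA leq_mul2r -!expnMn defN.
  by rewrite mulnAC -mulnA leqnn orbT.
have le3 : 8 ^ (8 * #|A|) * 7 ^ #|D| <= 8 ^ #|D|.
  have -> : #|D| = 16 * (8 * #|A|) by rewrite cD mulnA mulnC.
  exact: exp78M.
have p7 : 0 < 7 ^ #|D| by rewrite expn_gt0.
rewrite -(leq_pmul2r p7) [X in _ <= X]mulnC; apply: leq_trans le2.
rewrite -mulnA leq_mul2l; apply/orP; right; apply: leq_trans le3.
rewrite leq_mul2r leq_exp2l //; apply/orP; right.
by apply: leq_trans (eq_leq defN) _; rewrite leq_mul2l An orbT.
Qed.

Definition lower (u v : rvertex) := if u.1 < v.1 then u else v.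
Definition upper (u v : rvertex) := if u.1 < v.1 then v else u.

Lemma lower_upper_inj u v u' v' :
  lower u v = lower u' v' -> upper u v = upper u' v' ->
  (u = u' /\ v = v') \/ (u = v' /\ v = u').
Proof.
by rewrite /lower /upper; do 2!case: ifP => _; move=> -> ->; [left|right|right|left].
Qed.

Lemma uadj_slot phi (u v : rgraph phi) :
  uadj u v -> exists t, phi (lower u v, (upper u v).1, t) == (upper u v).2.
Proof.
rewrite /uadj /arc /= /rarc /lower /upper.
case: ltnP => [uv|_] /=; last by move=> /andP[_ /existsP].
by rewrite [v.1 < u.1]ltnNge (ltnW uv) orbF => /existsP.
Qed.

(** Each cycle is listed once for every start and direction. *)
Definition rcycle l phi : {set {ffun 'I_l -> rvertex}} :=
  [set c : {ffun 'I_l -> rvertex} |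
    injectiveb c && [forall k, @uadj (rgraph phi) (c k) (c (ordS k))]].

Lemma ordS_ordS_neq l (k : 'I_l) : 2 < l -> ordS (ordS k) != k.
Proof.
move=> l3; apply/eqP => /(congr1 val) /=; have := ltn_ord k.
have [lt|ge] := ltnP k.+1 l; last first.
  move=> kl; have -> : k.+1 = l by apply/eqP; rewrite eqn_leq ge kl.
  by rewrite modnn modn_small; lia.
rewrite (modn_small lt) => _; have [lt2|ge2] := ltnP k.+2 l.
  by rewrite modn_small //; lia.
have -> : k.+2 = l by apply/eqP; rewrite eqn_leq ge2 lt.
by rewrite modnn; lia.
Qed.

Lemma card_cycle_slots l (c : {ffun 'I_l -> rvertex}) (t : {ffun 'I_l -> 'I_d}) :
  2 < l -> injective c ->
  #|[set phi : sample | [forall k,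
      phi (lower (c k) (c (ordS k)), (upper (c k) (c (ordS k))).1, t k)
        == (upper (c k) (c (ordS k))).2]]| * N ^ l <= #|{: sample}|.
Proof.
move=> l3 injc; set M := [set phi | _].
have [->|[phi]] := set_0Vmem M; first by rewrite cards0.
rewrite inE => /forallP hphi.
(* Edges sharing a slot receive the same pick from [phi], hence have the same upper end and
   coincide; as [l > 2], their indices agree. *)
have inj : injective (fun k => (lower (c k) (c (ordS k)), (upper (c k) (c (ordS k))).1, t k)).
  move=> k k' eqk; have := hphi k; rewrite eqk (eqP (hphi k')) => /eqP eq2.
  case: eqk => eql equ1 _.
  have equ : upper (c k) (c (ordS k)) = upper (c k') (c (ordS k')).
    by rewrite [LHS]surjective_pairing equ1 -eq2 -surjective_pairing.
  have [[/injc//]|[/injc e1 /injc e2]] := lower_upper_inj eql equ.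
  by have := ordS_ordS_neq k' l3; rewrite -e1 e2 eqxx.
have := card_ffun_prescribed (fun k => (upper (c k) (c (ordS k))).2) inj.
by rewrite [#|'I_N|]card_ord.
Qed.

(** First moment: [(4 N)^l] vertex sequences, [d^l] choices of slots, and probability at most
    [N^(-l)] for each. *)
Lemma sum_card_rcycle l : 0 < N -> 2 < l ->
  \sum_(phi : sample) #|rcycle l phi| <= (4 * d) ^ l * #|{: sample}|.
Proof.
move=> N0 l3; have Nl : 0 < N ^ l by rewrite expn_gt0 N0.
pose Q (c : {ffun 'I_l -> rvertex}) (phi : sample) :=
  [forall k, @uadj (rgraph phi) (c k) (c (ordS k))].
rewrite -(leq_pmul2r Nl) 
  (leq_sum_card_swap (fun c : {ffun 'I_l -> rvertex} => injectiveb c) Q).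
apply: (@leq_trans (\sum_(c : {ffun 'I_l -> rvertex}) d ^ l * #|{: sample}|)); last first.
  rewrite sum_nat_const card_ffun card_prod !card_ord !expnMn.
  by rewrite -!mulnA leq_mul2l mulnCA leq_mul2l mulnC leqnn !orbT.
rewrite big_distrl /= big_mkcond; apply: leq_sum => c _.
case: ifP => // /injectiveP injc.
pose M (t : {ffun 'I_l -> 'I_d}) := [set phi : sample | [forall k,
      phi (lower (c k) (c (ordS k)), (upper (c k) (c (ordS k))).1, t k)
        == (upper (c k) (c (ordS k))).2]].
apply: (@leq_trans (#|\bigcup_t M t| * N ^ l)).
  rewrite leq_mul2r; apply/orP; right.
  apply/subset_leq_card/subsetP => phi; rewrite inE => /forallP adj.
  have [t ht] := fin_all_exists (fun k => uadj_slot (adj k)).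
  apply/bigcupP; exists (finfun t) => //; rewrite inE; apply/forallP => k.
  by rewrite ffunE.
apply: (@leq_trans ((\sum_t #|M t|) * N ^ l)).
  by rewrite leq_mul2r leq_card_bigcup orbT.
have -> : d ^ l * #|{: sample}| = \sum_(t : {ffun 'I_l -> 'I_d}) #|{: sample}|.
  by rewrite sum_nat_const (card_ffun 'I_l 'I_d) !card_ord.
by rewrite big_distrl; apply: leq_sum => t _; apply: card_cycle_slots.
Qed.

Definition unjoined_any : {set sample} :=
  \bigcup_(q : 'I_4 * 'I_4 * ({set 'I_N} * {set 'I_N}) | (n <= #|q.2.1|) && (n <= #|q.2.2|))
    unjoined q.1.1 q.1.2 q.2.1 q.2.2.

(** Union bound over [16 * 4 ^ N] choices, each of probability at most [8^(-N)]; the gain [2 ^ N] is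
    at least 256. *)
Lemma card_unjoined_any : d = 128 -> 0 < n -> #|unjoined_any| * 16 <= #|{: sample}|.
Proof.
move=> d128 n0; have p8 : 0 < 8 ^ N by rewrite expn_gt0.
rewrite -(leq_pmul2r p8).
apply: (@leq_trans (16 * (16 * 4 ^ N * #|{: sample}|))).
  rewrite mulnAC mulnC leq_mul2l /=.
  apply: leq_trans (leq_mul (leq_card_bigcup _ _) (leqnn _)) _.
  rewrite big_distrl /= big_mkcond /=.
  have -> : 16 * 4 ^ N * #|{: sample}| =
      \sum_(q : 'I_4 * 'I_4 * ({set 'I_N} * {set 'I_N})) #|{: sample}|.
    have cS : #|{set 'I_N}| = 2 ^ N by rewrite -cardsT -powersetT card_powerset cardsT card_ord.
    by rewrite sum_nat_const !card_prod !cS !card_ord -expnMn.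
  by apply: leq_sum => q _; case: ifP => // /andP[qn1 qn2]; apply: card_unjoined.
rewrite mulnA [leqRHS]mulnC leq_mul2r; apply/orP; right.
have -> : 8 ^ N = 2 ^ N * 4 ^ N by rewrite -expnMn.
rewrite mulnA leq_mul2r; apply/orP; right.
by rewrite (@leq_exp2l 2 8) // defN; case: (n) n0 => // m _; rewrite mulnS leq_addr.
Qed.

(** The lengths run from 3 to [g + 2], which covers all those up to [g]. *)
Definition short_cycles g (phi : sample) := \sum_(l < g) #|rcycle l.+3 phi|.

(** Averaging: the mean number of short cycles is at most [n / 2], and at most 1/16 of the samples
    are in [unjoined_any]. *)
Lemma good_sample g : d = 128 -> n = 2 * (4 * d) ^ (g + 3) ->
  exists2 phi : sample, phi \notin unjoined_any & short_cycles g phi <= n.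
Proof.
move=> d128 defn; have d4 : 1 < 4 * d by rewrite d128.
have n0 : 0 < n by rewrite defn muln_gt0 expn_gt0 (ltnW d4).
have N0 : 0 < N by rewrite defN muln_gt0.
have W0 : 0 < #|{: sample}| by rewrite card_ffun card_ord expn_gt0 N0.
have sum_rcycle l : \sum_(phi : sample) #|rcycle l.+3 phi| <= (4 * d) ^ l.+3 * #|{: sample}|.
  exact: sum_card_rcycle.
move: (4 * d) d4 sum_rcycle defn => a a1 sum_rcycle defn.
have a0 m : 0 < a ^ m by rewrite expn_gt0 (ltnW a1).
have [phi /andP[phi1 phi2]|bad] :=
  pickP [pred phi : sample | (phi \notin unjoined_any) && (short_cycles g phi <= n)].
  by exists phi.
have sum_geo : \sum_(phi : sample) short_cycles g phi <= a ^ (g + 3) * #|{: sample}|.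
  rewrite exchange_big /=; apply: (@leq_trans (\sum_(l < g) a ^ l.+3 * #|{: sample}|)).
    apply: leq_sum => l _; exact: sum_rcycle.
  rewrite -big_distrl leq_mul2r /=; apply/orP; right.
  (* The geometric sum is at most its next term because [a >= 2]. *)
  elim: (g) => [|h IHh]; first by rewrite big_ord0.
  rewrite big_ord_recr /= addSn [in leqRHS]expnS -[h.+3]addn3.
  by apply: leq_trans (leq_add IHh (leqnn _)) _; rewrite addnn -mul2n leq_mul2r a1 orbT.
have le_sum : (#|{: sample}| - #|unjoined_any|) * n <= \sum_(phi : sample) short_cycles g phi.
  rewrite -(cardsC unjoined_any) addKn -sum_nat_const.
  rewrite [leqRHS](bigID (fun phi => phi \in ~: unjoined_any)) /=.
  apply: leq_trans (leq_addr _ _); apply: leq_sum => phi; rewrite inE => phiN.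
  by have := bad phi; rewrite /= phiN /= => /negbT; rewrite -ltnNge => /ltnW.
have := card_unjoined_any d128 n0; have := leq_trans le_sum sum_geo.
move: W0; rewrite defn; move: (a ^ _) (a0 (g + 3)) => b.
move: #|unjoined_any| #|{: sample}| => u w w0 b0 h1 h2; clear -w0 b0 h1 h2; nia.
Qed.

(** One vertex per listed cycle; as all rotations are listed, these are all the vertices on short
    cycles. *)
Definition cycle_roots g phi : {set rvertex} :=
  \bigcup_(l < g) [set f ord0 | f : {ffun 'I_l.+3 -> rvertex} in rcycle l.+3 phi].

Lemma card_cycle_roots g phi : #|cycle_roots g phi| <= short_cycles g phi.
Proof.
by apply: leq_trans (leq_card_bigcup _ _) _; apply: leq_sum => l _; apply: leq_imset_card.
Qed.

Lemma cycle_rcycle phi l (c : seq (rgraph phi)) :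
  ucycle (@uadj (rgraph phi)) c -> size c = l.+3 ->
  exists2 f : {ffun 'I_l.+3 -> rvertex}, f \in rcycle l.+3 phi & f ord0 \in c.
Proof.
move=> /andP[cc uc] sc; have [x _] : exists x, x \in c.
  by case: (c) sc => // x c' _; exists x; apply: mem_head.
exists [ffun k : 'I_l.+3 => nth x c k]; last by rewrite ffunE mem_nth // sc.
rewrite inE; apply/andP; split.
  apply/injectiveP => k k'; rewrite !ffunE => /eqP; rewrite nth_uniq ?sc //.
  by move/eqP/val_inj.
apply/forallP => k; rewrite !ffunE /=; have kc : nth x c k \in c by rewrite mem_nth ?sc.
have := next_cycle cc kc; rewrite next_nth kc index_uniq ?sc //.
suff -> : match c with [::] => nth x c k | y :: p' => nth y p' k end = nth x c (k.+1 %% l.+3) by [].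
by rewrite (nth_cyclic_succ x) sc.
Qed.

Lemma girth_rgraph g phi :
  girth_gt (@induced (rgraph phi) (~: cycle_roots g phi)) g.
Proof.
apply/girth_gtP => c /andP[cc uc] c3; rewrite ltnNge; apply/negP => cg.
pose c' : seq (rgraph phi) := map val c.
have uc' : ucycle (@uadj (rgraph phi)) c'.
  by rewrite /ucycle cycle_map cc map_inj_uniq //; apply: val_inj.
have sc' : size c' = (size c - 3).+3 by rewrite size_map -[RHS]addn3 subnK.
have [f fR /mapP[x _ fx]] := cycle_rcycle uc' sc'.
have := valP x; rewrite -fx inE => /bigcupP[].
have lt_g : size c - 3 < g.
  by rewrite ltn_subLR // (leq_ltn_trans cg) // -[g.+1]add1n leq_add2r.
by exists (Ordinal lt_g) => //; apply/imsetP; exists f.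
Qed.

Lemma rgraph_no_hom g phi : 0 < n -> phi \notin unjoined_any -> short_cycles g phi <= n ->
  ~ exists f : @induced (rgraph phi) (~: cycle_roots g phi) -> paley, is_hom f.
Proof.
move=> n0 joined few /(@hom_induced _ paley _ (ord0 : 'I_7))[f hf].
pose A i c := [set x | ((i, x) \notin cycle_roots g phi) && (f (i, x) == c)].
(* At least [7 n] of the [8 n] vertices of each layer survive, so one of the 7 colours occurs [n]
   times. *)
have popular i : exists c, n <= #|A i c|.
  pose R := [set x | (i, x) \notin cycle_roots g phi].
  have RC : #|~: R| <= n.
    rewrite -(card_imset _ (_ : injective (fun x => (i, x)))) => [|x y []//].
    apply: leq_trans (leq_trans (card_cycle_roots g phi) few); apply: subset_leq_card.
    by apply/subsetP => _ /imsetP[x xR ->]; rewrite !inE negbK in xR.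
  have R7 : 7 * n <= #|R|.
    have : N <= #|R| + n by rewrite -[leqLHS]card_ord -(cardsC R) leq_add2l.
    move=> h; have := leq_trans (eq_leq (esym defN)) h; rewrite -[8]/(7 + 1) mulnDl mul1n.
    by rewrite leq_add2r.
  have [c hc|small] := pickP [pred c | n <= #|A i c|]; first by exists c.
  have : #|R| <= \sum_(c : 'I_7) #|A i c|.
    apply: leq_trans (leq_card_bigcup _ _); apply/subset_leq_card/subsetP => x.
    by rewrite inE => xR; apply/bigcupP; exists (f (i, x)); rewrite // inE xR eqxx.
  have : \sum_(c : 'I_7) #|A i c| <= \sum_(c : 'I_7) n.-1.
    by apply: leq_sum => c _; have /= := small c; lia.
  by rewrite sum_nat_const card_ord; lia.
have [c hc] := fin_all_exists popular.
have homc : @is_hom (transitive_tournament 4) paley c.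
  (* Without an arc between the two popular colours, no pick would join their classes, so [phi]
     would be in [unjoined_any]. *)
  move=> i j ij; apply: contraNT joined => nij; apply/bigcupP.
  exists (i, j, (A i (c i), A j (c j))); rewrite /= ?hc //.
  rewrite inE; apply/forall_inP => a; rewrite inE => /andP[aN /eqP fa].
  apply/forallP => t; rewrite inE; apply: contra nij => /andP[bN /eqP fb].
  rewrite -fa -fb; apply: hf; rewrite ?in_setC //.
  by apply/andP; split => //; apply/existsP; exists t.
apply: paley_free4; exists c => // i j eqc; apply/val_inj/eqP.
by case: (ltngtP i j) => // /homc; rewrite eqc arc_irr.
Qed.

Lemma rgraph_layered phi (B : {set rgraph phi}) :
  exists f : induced B -> transitive_tournament 4, is_hom f.
Proof. by exists (fun u => (val u).1) => u v /andP[]. Qed.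

End RandomGraph.

(** * Upper bound on the minimum order *)

Lemma exists_high_girth g : exists H : ograph,
  [/\ #|H| <= 2 ^ (9 * g + 33), girth_gt H g,
      exists f : H -> transitive_tournament 4, is_hom f &
      ~ exists f : H -> paley, is_hom f].
Proof.
(* The constants are hidden behind equations, so that large powers are not evaluated. *)
have [d d128] : exists d, d = 128 by exists 128.
have [n defn] : exists n, n = 2 * (4 * d) ^ (g + 3) by eexists.
have [N defN] : exists N, N = 8 * n by eexists.
have n0 : 0 < n by rewrite defn muln_gt0 expn_gt0 d128.
have [phi joined few] := good_sample defN d128 defn.
exists (@induced (rgraph phi) (~: cycle_roots g phi)); split.
- rewrite card_induced; apply: leq_trans (max_card _) _.
  rewrite card_prod !card_ord defN defn.
  have -> : 4 * d = 2 ^ 9 by rewrite d128.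
  rewrite -expnM (_ : 9 * g + 33 = 6 + 9 * (g + 3)); last by lia.
  by rewrite expnD (_ : 2 ^ 6 = 4 * 8 * 2) // !mulnA.
- exact: girth_rgraph.
- exact: rgraph_layered.
- exact: (rgraph_no_hom defN n0 joined few).
Qed.

Lemma family_nonempty g : exists2 H : ograph, family g 4 H & #|H| <= 2 ^ (9 * g + 87).
Proof.
(* This makes the girth exceed both [g], for the family, and 6, for the clique numbers. *)
have [H [cardH girthH [f homf] nohom]] := exists_high_girth (g + 6).
have [A [nohomA crit]] := critical_subgraph (ord0 : paley) nohom.
have gA := girth_induced A girthH.
have gA_gt k : k <= g + 6 -> girth_gt (induced A) k.
  move=> kg; apply/girth_gtP => c uc c3.
  by move/girth_gtP: gA => /(_ c uc c3); apply: leq_ltn_trans.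
have homA : is_hom (f \o (fun x : induced A => val x)).
  exact: hom_comp (@induced_val_hom _ A) homf.
have acA := acyclic_layered homA; have pA := pathnum_layered homA.
have p4 := pathnum_eq4 acA pA nohomA.
exists (induced A).
  split; rewrite ?r_tr4 ?compressibility_eq8 //.
  - by split=> //; apply: critical_connected nohomA crit.
  - by apply: gA_gt; rewrite leq_addr.
  - by apply: clique_numbers; rewrite ?p4 // gA_gt // leq_addl.
rewrite card_induced; apply: leq_trans (max_card _) (leq_trans cardH _).
by rewrite leq_exp2l // mulnDr -addnA.
Qed.

(** As the family is nonempty, the minimum is attained and is not the junk value of [least]. *)
Lemma min_orderP g : exists2 H : ograph, family g 4 H & #|H| = min_order g 4.
Proof.
have [H famH _] := family_nonempty g.
have [|//] := @leastP (fun n => exists2 H, family g 4 H & #|vertex H| = n) #|H|.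
by exists H.
Qed.

Lemma min_order_lower g : 4 <= g -> 3 * 2 ^ (g %/ 4) - 2 <= min_order g 4.
Proof.
move=> g4; have [H [[_ acH] gH _ pH cH] <-] := min_orderP g.
by apply: compressibility8_order; rewrite // cH r_tr4.
Qed.

Lemma min_order_upper g : min_order g 4 <= 2 ^ (9 * g + 87).
Proof.
have [H famH leH] := family_nonempty g; apply: leq_trans leH.
have [|//] := @leastP (fun n => exists2 H, family g 4 H & #|vertex H| = n) #|H|.
by exists H.
Qed.

(** * Asymptotics *)

From mathcomp Require Import all_order all_algebra polyXY.
From mathcomp Require Import all_classical all_reals all_analysis.
Import Order.TTheory GRing.Theory Num.Theory numFieldNormedType.Exports.
Local Open Scope classical_set_scope.
Local Open Scope ring_scope.

Lemma poly_le_monomial (R : realDomainType) (q : {poly R}) (x : R) : 1 <= x ->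
  q.[x] <= (\sum_(i < size q) `|q`_i|) * x ^+ size q.
Proof.
move=> x1; have x0 : 0 <= x by apply: le_trans x1.
rewrite horner_coef mulr_suml; apply: ler_sum => i _.
apply: (@le_trans _ _ (`|q`_i| * x ^+ i)).
  by apply: ler_wpM2r; [apply: exprn_ge0|apply: ler_norm].
by apply: ler_wpM2l => //; apply: ler_weXn2l => //; apply: ltnW.
Qed.

(** With [m = k (n + 1)] and [k] large, [q] at [4 m] is at most [C (4 (n + 1))^n k^n <= k^(n + 1)],
    which is below [(2^k)^(n + 1) = 2^m]. *)
Lemma poly_lt_exp (R : archiRealDomainType) (q : {poly R}) :
  exists2 m : nat, (0 < m)%N & q.[(4 * m)%:R] < 2 ^+ m.
Proof.
set n := size q; set C := \sum_(i < n) `|q`_i|.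
pose k := (Num.bound (C * (4 * n.+1)%:R ^+ n)).+1.
have C0 : 0 <= C by apply: sumr_ge0.
have Ck : C * (4 * n.+1)%:R ^+ n <= k%:R.
  apply/ltW/(@lt_trans _ _ (Num.bound (C * (4 * n.+1)%:R ^+ n))%:R); last by rewrite ltr_nat.
  by apply: archi_boundP; rewrite mulr_ge0 // exprn_ge0.
exists (k * n.+1)%N; first by rewrite muln_gt0.
apply: (@le_lt_trans _ _ (C * (4 * (k * n.+1))%:R ^+ n)).
  by apply: poly_le_monomial; rewrite ler1n !muln_gt0.
rewrite mulnCA natrM exprMn mulrCA exprM.
apply: (@le_lt_trans _ _ (k%:R ^+ n * k%:R)).
  by apply: ler_wpM2l => //; rewrite exprn_ge0.
rewrite -exprSr ltrXn2r // -natrX ltr_nat; exact: ltn_expl.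
Qed.

Lemma log_min_order (R : realType) (g : nat) : (4 <= g)%N ->
  (min_order g 4)%:R = 2 `^ (ln (min_order g 4)%:R / ln 2) :> R.
Proof.
move=> g4; have ln2 : 0 < ln 2 :> R by rewrite ln_gt0 // ltr1n.
rewrite /powR pnatr_eq0 /= divfK ?gt_eqF // lnK // posrE ltr0n.
by apply: leq_trans (min_order_lower g4); rewrite subn_gt0 (@leq_trans (3 * 1)) // leq_mul2l expn_gt0.
Qed.

Lemma log_min_order_Theta (R : realType) :
  (fun g : nat => ln (min_order g 4)%:R / ln 2 : R) \is 'Theta_\oo (fun g : nat => g%:R : R).
Proof.
have ln2 : 0 < ln 2 :> R by rewrite ln_gt0 // ltr1n.
(* For large [g], the integer part of [g / 4] is at least [g / 8], and [9 g + 87 <= 10 g]. *)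
rewrite qualifE; apply/asboolP; exists (8^-1, 10); first by rewrite /= invr_gt0 !ltr0n.
near=> g; have g8 : (100 <= g)%N by near: g; exists 100%N.
have g4 : (4 <= g)%N by apply: leq_trans g8.
have lower : (2 ^ (g %/ 4) <= min_order g 4)%N.
  apply: leq_trans (min_order_lower g4); have : (0 < 2 ^ (g %/ 4))%N by rewrite expn_gt0.
  lia.
have upper := min_order_upper g.
have m0 : (0 < min_order g 4)%N by apply: leq_trans lower; rewrite expn_gt0.
have ln_ge : (g %/ 4)%:R * ln 2 <= ln (min_order g 4)%:R :> R.
  rewrite mulr_natl -lnXn // ler_ln ?posrE ?exprn_gt0 ?ltr0n //.
  by rewrite -natrX ler_nat.
have ln_le : ln (min_order g 4)%:R <= (9 * g + 87)%:R * ln 2 :> R.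
  rewrite mulr_natl -lnXn // ler_ln ?posrE ?exprn_gt0 ?ltr0n //.
  by rewrite -natrX ler_nat.
rewrite /= !ger0_norm ?divr_ge0 ?ler0n //; last 2 first.
- by apply: le_trans ln_ge; rewrite mulr_ge0 // ltW.
- exact: ltW.
rewrite ler_pdivlMr // ler_pdivrMr //; split.
  apply: le_trans ln_ge; apply: ler_wpM2r; first exact: ltW.
  by rewrite ler_pdivrMl ?ltr0n // -natrM ler_nat; lia.
apply: le_trans ln_le _; apply: ler_wpM2r; first exact: ltW.
by rewrite -natrM ler_nat; lia.
Unshelve. all: by end_near.
Qed.

Theorem lemma4p3 (R : realType) :
  [/\ forall (g : nat) (H : ograph), (4 <= g)%N -> acyclic H ->
        pathnum H = 4%N -> compressibility H = 8%N -> girth_gt H g ->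
        (3 * 2 ^ (g %/ 4) - 2 <= #|H|)%N,
      forall g : nat, (4 <= g)%N -> (3 * 2 ^ (g %/ 4) - 2 <= min_order g 4)%N,
      exists2 f : nat -> R, f \is 'Theta_\oo (fun g : nat => g%:R : R) &
        \forall g \near \oo, (min_order g 4)%:R = 2 `^ (f g)
    & ~ exists P : {poly {poly R}}, forall p g : nat,
          (3 <= p)%N -> (1 <= g)%N -> (min_order g p)%:R <= P.[p%:R, g%:R]].
Proof.
split.
- exact: compressibility8_order.
- exact: min_order_lower.
- exists (fun g => ln (min_order g 4)%:R / ln 2); first exact: log_min_order_Theta.
  by exists 4%N => // g /= g4; apply: log_min_order.
(* Fixing [p = 4] leaves a polynomial in [g], which at some [g = 4 m] is below [2 ^ m], hence below
   [3 * 2 ^ m - 2]. *)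
- case=> P leP; have [m m0 lt_m] := poly_lt_exp P.[4%:R%:P].
  have := leP 4%N (4 * m)%N isT; rewrite muln_gt0 m0 => /(_ isT) le_m.
  have := le_lt_trans le_m lt_m; rewrite -natrX ltr_nat ltnNge => /negP[].
  have g4 : (4 <= 4 * m)%N by rewrite leq_pmulr.
  apply: leq_trans (min_order_lower g4); rewrite mulKn //.
  by have : (0 < 2 ^ m)%N := expn_gt0 2 m; lia.
Qed.
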